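(* Let $\{k_1,k_2,\dots,k_m\}$ be a finite subset of the real Hilbert space $H$, and let $C:=\left\{\sum_{i=1}^m\rho_i k_i\mid \rho_i\ge 0\text{ for all }i\right\}$ be the (closed) convex cone it generates. Then for each $x\in H$, $$P_{C^\ominus}(x)=x-\sum_{i=1}^m\rho_i k_i\quad\text{and}\quad P_C(x)=\sum_{i=1}^m\rho_i k_i$$ for any set of scalars $\rho_i$ that satisfy the following three conditions: $$\rho_i\ge 0\quad(i=1,2,\dots,m),$$ $$\langle x,k_i\rangle-\sum_{j=1}^m\rho_j\langle k_j,k_i\rangle\le 0\quad(i=1,2,\dots,m),$$ and $$\rho_i\Big[\langle x,k_i\rangle-\sum_{j=1}^m\rho_j\langle k_j,k_i\rangle\Big]=0\quad(i=1,2,\dots,m).$$ Moreover, if $x\in H$ and $x_0\in C^\ominus$, then $x_0=P_{C^\ominus}(x)$ if and only if $$x_0=x-\sum_{i\in I(x_0)}\rho_i k_i\quad\text{for some }\rho_i\ge 0,$$ where $I(x_0):=\{i\mid\langle x_0,k_i\rangle=0\}$.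
   Context: All spaces are real. For $S\subset H$, $S^\ominus:=\{y\in H\mid\langle y,s\rangle\le 0\text{ for all }s\in S\}$; here $C^\ominus=\{y\in H\mid\langle y,k_i\rangle\le 0\text{ for all }i=1,\dots,m\}$. For a nonempty closed convex set $D\subset H$ and $x\in H$, $P_D(x)$ is the unique best approximation (nearest point) to $x$ in $D$. *)

(* Defs.v *)
From HB Require Import structures.
From mathcomp Require Import all_boot all_order all_algebra.
From mathcomp Require Import all_classical all_reals all_analysis.
From mathcomp Require Import ring lra.

Set Implicit Arguments.
Unset Strict Implicit.
Unset Printing Implicit Defensive.

Import Order.TTheory GRing.Theory Num.Theory.
Import numFieldNormedType.Exports.

Local Open Scope classical_set_scope.
Local Open Scope ring_scope.

HB.mixin Record CompleteNormedModule_isHilbert (R : realType) (H : Type)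
    of CompleteNormedModule R H := {
  hdot : H -> H -> R ;
  hdotC : forall x y, hdot x y = hdot y x ;
  hdot_linearl : forall (a : R) x y z,
    hdot (a *: x + y) z = a * hdot x z + hdot y z ;
  hdot_normE : forall x, `|x| ^+ 2 = hdot x x
}.

#[short(type="hilbertType")]
HB.structure Definition Hilbert (R : realType) :=
  {H of CompleteNormedModule R H & CompleteNormedModule_isHilbert R H}.

Notation "''[' u , v ]" := (hdot u v) : ring_scope.

Definition best_approx (R : realType) (H : hilbertType R)
    (D : set H) (x : H) : set H :=
  [set p | D p /\ forall y, D y -> `|x - p| <= `|x - y|].

(* Outside nonempty closed convex sets the value may be junk: 0 when there is
   no best approximation, an arbitrary one when there are several. See
   metric_projP and metric_proj_unique below. *)
Definition metric_proj (R : realType) (H : hilbertType R)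
    (D : set H) (x : H) : H :=
  xget 0 (best_approx D x).

Definition dual_cone (R : realType) (H : hilbertType R) (S : set H) : set H :=
  [set y | forall s, S s -> '[y, s] <= 0].

Definition cone_hull (R : realType) (H : hilbertType R) (m : nat)
    (k : 'I_m -> H) : set H :=
  [set \sum_(i < m) rho i *: k i | rho in [set rho : 'I_m -> R |
                                           forall i, 0 <= rho i]].

Section dot.
Context {R : realType} {H : hilbertType R}.

Let hdot_bilinear : bilinear_for
  (GRing.Scale.Law.clone _ _ *%R _)
  (GRing.Scale.Law.clone _ _ (idfun \; *%R) _) (@hdot R H).
Proof.
split=> [z a x y|z a x y] /=; first exact: hdot_linearl.
by rewrite !(hdotC z) hdot_linearl.
Qed.

HB.instance Definition _ :=
  bilinear_isBilinear.Build R H H R *%R (idfun \; *%R) (@hdot R H)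
    hdot_bilinear.

Let hdot_herm x y : @hdot R H x y = (-1) ^+ false * idfun (hdot y x).
Proof. by rewrite expr0 mul1r hdotC. Qed.

HB.instance Definition _ :=
  isHermitianSesquilinear.Build R H false idfun (@hdot R H) hdot_herm.

Let hdot_gt0 (x : H) : x != 0 -> 0 < hdot x x.
Proof. by move=> x0; rewrite -hdot_normE exprn_gt0// normr_gt0. Qed.

HB.instance Definition _ := isDotProduct.Build R H (@hdot R H) hdot_gt0.

End dot.

Section theory.
Context {R : realType} {H : hilbertType R}.
Implicit Types (D : set H) (x y p q : H).

Lemma hdotDr x y z : '[x, y + z] = '[x, y] + '[x, z].
Proof. by rewrite linearDr. Qed.

Lemma hdotDl x y z : '[x + y, z] = '[x, z] + '[y, z].
Proof. by rewrite linearDl. Qed.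

Lemma hdotNr x y : '[x, - y] = - '[x, y].
Proof. by rewrite linearNr. Qed.

Lemma hdotZr a x y : '[x, a *: y] = a * '[x, y].
Proof. by rewrite linearZr_LR. Qed.

Lemma hdot_sumr (I : Type) (r : seq I) (P : pred I) (F : I -> H) x :
  '[x, \sum_(i <- r | P i) F i] = \sum_(i <- r | P i) '[x, F i].
Proof. by rewrite linear_sumr. Qed.

Lemma sqr_hnormD x y : `|x + y| ^+ 2 = `|x| ^+ 2 + 2 * '[x, y] + `|y| ^+ 2.
Proof. rewrite !hdot_normE hdotDl !hdotDr (hdotC y x); ring. Qed.

Lemma sqr_hnormB x y : `|x - y| ^+ 2 = `|x| ^+ 2 - 2 * '[x, y] + `|y| ^+ 2.
Proof. rewrite sqr_hnormD normrN hdotNr; ring. Qed.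

Lemma dual_cone_hullE (m : nat) (k : 'I_m -> H) :
  dual_cone (cone_hull k) = [set y | forall i, '[y, k i] <= 0].
Proof.
apply/seteqP; split => y /= yk.
  move=> i; apply: yk; exists (fun j => (j == i)%:R) => [j|]; first exact: ler0n.
  rewrite (bigD1 i)//= eqxx scale1r big1 ?addr0// => j /negbTE ->.
  by rewrite scale0r.
move=> _ [rho rho0 <-]; rewrite hdot_sumr; apply: sumr_le0 => i _.
by rewrite hdotZr mulr_ge0_le0.
Qed.

Lemma parallelogram_dist D x p q (d : R) :
  convex_set (D : set (convex_lmodType H)) -> D p -> D q ->
  0 <= d -> (forall y, D y -> d <= `|x - y|) ->
  `|p - q| ^+ 2 <= 2 * (`|x - p| ^+ 2 - d ^+ 2) + 2 * (`|x - q| ^+ 2 - d ^+ 2).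
Proof.
move=> cD Dp Dq d0 dD.
have Dh : D (2^-1 *: (p + q)).
  have h0 : 0 <= 2^-1 :> R by lra.
  have h1 : 2^-1 <= 1 :> R by lra.
  have /set_mem := cD p q (Itv01 h0 h1) (mem_set Dp) (mem_set Dq).
  congr (D _); rewrite scalerDr; congr (_ + _ *: _).
  by rewrite /unstable.onem/=; lra.
have := dD _ Dh; rewrite -(ler_pXn2r (n := 2)) ?nnegrE//.
have -> : x - 2^-1 *: (p + q) = 2^-1 *: ((x - p) + (x - q)).
  rewrite [in RHS]addrACA -opprD scalerBr; congr (_ - _).
  by rewrite -mulr2n -(scaler_nat 2 x) scalerA mulVf ?scale1r.
have -> : p - q = (x - q) - (x - p) by rewrite opprB [RHS]addrC addrA subrK.
move: (x - p) (x - q) => a b; rewrite normrZ exprMn sqr_hnormB (sqr_hnormD a).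
rewrite (hdotC b) gtr0_norm ?invr_gt0//; lra.
Qed.

Lemma best_approx_unique D x p q :
  convex_set (D : set (convex_lmodType H)) ->
  best_approx D x p -> best_approx D x q -> p = q.
Proof.
move=> cD [Dp xp] [Dq xq].
have pq : `|x - p| = `|x - q| by apply/eqP; rewrite eq_le xp// xq.
have := parallelogram_dist cD Dp Dq (normr_ge0 (x - p)) xp.
rewrite -pq subrr !mulr0 addr0 => h.
apply/eqP; rewrite -subr_eq0 -normr_eq0 -sqrf_eq0; apply/eqP/le_anti.
by rewrite h sqr_ge0.
Qed.

Lemma best_approx_exists D x : D !=set0 -> closed D ->
  convex_set (D : set (convex_lmodType H)) -> best_approx D x !=set0.
Proof.
move=> [y0 Dy0] clD cD.
pose E := [set `|x - y| | y in D].
have infE : has_inf E.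
  split; first by exists `|x - y0|, y0.
  by exists 0 => _ [y _ <-].
pose d := inf E.
have d0 : 0 <= d by apply: lb_le_inf; [case: infE|move=> _ [y _ <-]].
have dD y : D y -> d <= `|x - y| by move=> Dy; apply: ge_inf; [case: infE|exists y].
have uP n : exists y, D y /\ `|x - y| < d + n.+1%:R^-1.
  have [|_ [y Dy <-] h] := inf_adherent (_ : 0 < n.+1%:R^-1) infE.
    by rewrite invr_gt0.
  by exists y.
have [u uE] := choice uP.
have Du n : D (u n) by case: (uE n).
have nu : (fun n => `|x - u n|) @ \oo --> d.
  apply: (@squeeze_cvgr _ _ _ _ (fun=> d) (fun n => d + n.+1%:R^-1)).
  - by near=> n; rewrite dD//= ltW//; case: (uE n).
  - exact: cvg_cst.
  - rewrite -[X in _ --> X]addr0; apply: cvgD; first exact: cvg_cst.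
    exact: cvg_harmonic.
have nu2 : (fun n => `|x - u n| ^+ 2 - d ^+ 2) @ \oo --> (0 : R).
  rewrite -(subrr (d ^+ 2)); apply: cvgB; last exact: cvg_cst.
  by rewrite expr2; apply: cvgM.
have cu : cvg (u @ \oo).
  apply/cauchy_cvgP/cauchy_exP => e e0.
  have e2 : 0 < e ^+ 2 / 4 by rewrite divr_gt0// exprn_gt0.
  have /cvgrPdist_lt/(_ _ e2)[N _ hN] := nu2.
  exists (u N); exists N => // n /= Nn.
  rewrite -ball_normE /= -(ltr_pXn2r (n := 2)) ?nnegrE// ?ltW//.
  apply: le_lt_trans (parallelogram_dist cD (Du N) (Du n) d0 dD) _.
  have := hN _ (leqnn N); have := hN _ Nn.
  rewrite /= !sub0r !normrN !ltr_norml => /andP[_ h1] /andP[_ h2]; lra.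
exists (lim (u @ \oo)); split.
  by apply: (@closed_cvg _ _ _ _ u D clD _ _ cu); near=> n; exact: Du.
move=> y Dy; apply: le_trans (dD _ Dy).
have nl : (fun n => `|x - u n|) @ \oo --> `|x - lim (u @ \oo)|.
  by apply: cvg_norm; apply: cvgB; [exact: cvg_cst|exact: cu].
by rewrite -(cvg_lim (@Rhausdorff R) nl) (cvg_lim (@Rhausdorff R) nu).
Unshelve. all: by end_near.
Qed.

Lemma metric_projP D x : D !=set0 -> closed D ->
  convex_set (D : set (convex_lmodType H)) ->
  best_approx D x (metric_proj D x).
Proof. by move=> D0 clD cD; apply: xgetPex; exact: best_approx_exists. Qed.

Lemma metric_proj_unique D x p : convex_set (D : set (convex_lmodType H)) ->
  best_approx D x p -> metric_proj D x = p.
Proof.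
move=> cD xp; apply: xget_unique => // q xq.
exact: best_approx_unique cD xq xp.
Qed.

End theory.

(* Main.v *)
Require Import Defs.
From mathcomp Require Import all_boot all_order all_algebra.
From mathcomp Require Import all_classical all_reals all_analysis.
From mathcomp Require Import lra.

Import Order.TTheory GRing.Theory Num.Theory.
Import numFieldNormedType.Exports.

Local Open Scope classical_set_scope.
Local Open Scope ring_scope.

(** Write [x = p + c] with [p] in the dual cone of [C], [c] in [C] and
    ['[p, c] = 0].  Expanding squared norms shows at once that [p] is the best
    approximation of [x] in the dual cone and [c] the best approximation in
    [C] ([orthogonal_decomposition_proj]; this is the easy half of Moreau's
    decomposition theorem).  The three conditions on the scalars [rho] say
    exactly that [c := \sum_i rho i *: k i] and [p := x - c] form such a
    decomposition: the second one puts [p] in the dual cone, the sum of the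
    third ones is orthogonality.  Likewise, a combination of the [k i] that are
    orthogonal to [x0] is orthogonal to [x0].

    For the converse, let [x0] be the projection of [x] on the dual cone.
    First-order optimality along the rays of that cone gives ['[x - x0, y] <= 0]
    for all its elements [y], and ['[x - x0, x0] = 0] since one may move along
    [x0] in both directions.  Farkas' lemma ([farkas]) turns the former into
    [x - x0 = \sum_i rho i *: k i] with [rho >= 0].  Then
    [\sum_i rho i * '[x0, k i] = 0] is a sum of nonpositive terms, so that
    [rho i = 0] whenever ['[x0, k i] != 0].

    Farkas' lemma is proved by an algebraic induction on the number of
    generators, which makes it unnecessary to show that a finitely generated
    cone is closed. *)

Section cones.
Set Implicit Arguments.
Unset Strict Implicit.
Context {R : realType} {H : hilbertType R}.
Implicit Types (D C : set H) (x y z p c v : H).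

Lemma hdotNl x y : '[- x, y] = - '[x, y].
Proof. by rewrite hdotC hdotNr hdotC. Qed.

Lemma hdotBl x y z : '[x - y, z] = '[x, z] - '[y, z].
Proof. by rewrite hdotDl hdotNl. Qed.

Lemma hdotBr x y z : '[x, y - z] = '[x, y] - '[x, z].
Proof. by rewrite hdotDr hdotNr. Qed.

Lemma hdotZl a x y : '[a *: x, y] = a * '[x, y].
Proof. by rewrite hdotC hdotZr hdotC. Qed.

Lemma convex_set_cone D :
  (forall a b p q, 0 <= a -> 0 <= b -> D p -> D q -> D (a *: p + b *: q)) ->
  convex_set (D : set (convex_lmodType H)).
Proof.
move=> coneD p q t /set_mem Dp /set_mem Dq; apply/mem_set.
by apply: coneD => //; rewrite /unstable.onem subr_ge0.
Qed.

Lemma convex_cone_hull m (k : 'I_m -> H) :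
  convex_set (cone_hull k : set (convex_lmodType H)).
Proof.
apply: convex_set_cone => a b _ _ a0 b0 [r r0 <-] [s s0 <-].
exists (fun i => a * r i + b * s i) => [i|] /=.
  by rewrite addr_ge0 ?mulr_ge0.
rewrite !scaler_sumr -big_split; apply: eq_bigr => i _ /=.
by rewrite scalerDl !scalerA.
Qed.

Lemma dual_cone_comb C a b p q : 0 <= a -> 0 <= b ->
  dual_cone C p -> dual_cone C q -> dual_cone C (a *: p + b *: q).
Proof.
move=> a0 b0 Cp Cq s Cs.
by rewrite hdotDl !hdotZl -oppr_ge0 opprD -!mulrN addr_ge0 ?mulr_ge0 ?oppr_ge0
  ?Cp ?Cq.
Qed.

Lemma convex_dual_cone C :
  convex_set (dual_cone C : set (convex_lmodType H)).
Proof. by apply: convex_set_cone => a b p q; exact: dual_cone_comb. Qed.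

Lemma dual_cone0 C : dual_cone C 0.
Proof. by move=> s _; rewrite -(scale0r s) hdotZl mul0r. Qed.

(** By polarization, the half-space ['[y, s] <= 0] is a sublevel set of the
    continuous function [`|y + s| ^+ 2 - `|y| ^+ 2]. *)
Lemma closed_dual_cone C : closed (dual_cone C).
Proof.
have -> : dual_cone C = \bigcap_(s in C)
    ((fun y => `|y + s| ^+ 2 - `|y| ^+ 2) @^-1` [set r | r <= `|s| ^+ 2]).
  apply/seteqP; split => y Cy s Cs /=.
    by have := Cy s Cs; rewrite sqr_hnormD; lra.
  by have := Cy s Cs; rewrite /= sqr_hnormD; lra.
apply: closed_bigI => s _; apply: preimage_closed; last exact: closed_le.
move=> y _.
have cn : (fun y : H => `|y + s|) @ y --> `|y + s|.
  by apply: cvg_norm; apply: cvgD; [exact: cvg_id|exact: cvg_cst].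
have cn0 : (fun y : H => `|y|) @ y --> `|y| by apply: cvg_norm; exact: cvg_id.
by apply: cvgB; rewrite expr2; apply: cvgM.
Qed.

(** If [y] lies in the set, then ['[x - p, y - p] = '[x - p, y] <= 0], so moving
    from [p] to [y] cannot decrease the distance to [x]. *)
Lemma best_approx_obtuse D x p : D p -> '[x - p, p] = 0 ->
  (forall y, D y -> '[x - p, y] <= 0) -> best_approx D x p.
Proof.
move=> Dp xp0 obt; split=> // y Dy.
rewrite -(ler_pXn2r (n := 2)) ?nnegrE//.
have -> : x - y = (x - p) - (y - p) by rewrite opprB addrA subrK.
rewrite (sqr_hnormB (x - p)) hdotBr xp0.
by have := obt y Dy; have := sqr_ge0 `|y - p|; lra.
Qed.

Lemma orthogonal_decomposition_proj C p c :
  convex_set (C : set (convex_lmodType H)) ->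
  dual_cone C p -> C c -> '[p, c] = 0 ->
  metric_proj (dual_cone C) (p + c) = p /\ metric_proj C (p + c) = c.
Proof.
move=> cC Cp Cc pc; split; apply: metric_proj_unique => //.
- exact: convex_dual_cone.
- by apply: best_approx_obtuse => [//||y Cy]; rewrite addrC addKr hdotC// Cy.
- by apply: best_approx_obtuse => [//||y Cy]; rewrite addrK ?Cp.
Qed.

(** First-order optimality: the derivative at [t = 0] of
    [`|x - (p + t *: u)| ^+ 2] is [- 2 * '[x - p, u]]. *)
Lemma best_approx_direction D x p u : best_approx D x p ->
  (forall t, 0 < t -> t <= 1 -> D (p + t *: u)) -> '[x - p, u] <= 0.
Proof.
move=> [_ pmin] Du; rewrite leNgt; apply/negP => a0.
set a := '[x - p, u] in a0.
have b0 : 0 <= `|u| ^+ 2 by exact: sqr_ge0.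
set b := `|u| ^+ 2 in b0.
(* [t] is small enough for [t * b < 2 * a], so the step shortens the distance *)
pose t := a / (a + b).
have ab0 : 0 < a + b by lra.
have t0 : 0 < t by rewrite divr_gt0.
have t1 : t <= 1 by rewrite ler_pdivrMr//; lra.
have tb : t * b < 2 * a.
  have -> : t * b = a * b / (a + b) by rewrite /t mulrAC.
  by rewrite ltr_pdivrMr//; nra.
have := pmin _ (Du t t0 t1); rewrite -(ler_pXn2r (n := 2)) ?nnegrE//.
rewrite opprD addrA (sqr_hnormB (x - p)) hdotZr normrZ exprMn gtr0_norm//.
by rewrite -/a -/b; nra.
Qed.

Lemma best_approx_dual_cone C x p : best_approx (dual_cone C) x p ->
  '[x - p, p] = 0 /\ (forall y, dual_cone C y -> '[x - p, y] <= 0).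
Proof.
move=> xp; have [Cp _] := xp.
have obt y : dual_cone C y -> '[x - p, y] <= 0.
  move=> Cy; apply: (best_approx_direction xp) => t t0 _.
  by rewrite -[p]scale1r; apply: dual_cone_comb => //; exact: ltW.
split=> //; apply/le_anti; rewrite obt//= -oppr_le0 -hdotNr.
apply: (best_approx_direction xp) => t _ t1.
have -> : p + t *: (- p) = (1 - t) *: p + 0 *: p.
  by rewrite scale0r addr0 scalerBl scale1r scalerN.
by apply: dual_cone_comb => //; rewrite subr_ge0.
Qed.

(** Farkas' lemma, by induction on the number of generators.  If the
    constraint of [k ord0] is essential, some [y0] satisfies the other
    constraints but has ['[y0, v] > 0], hence ['[y0, k ord0] > 0].  Subtracting
    multiples of [k ord0] makes [v] and the other generators orthogonal to
    [y0]; the hypothesis survives because any [y] can be moved along [y0] into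
    the hyperplane orthogonal to [k ord0] without changing its products with
    the modified vectors.  The sign of the coefficient recovered for [k ord0]
    comes from the choice of [y0]. *)
Lemma farkas m (k : 'I_m -> H) v :
  (forall y, (forall i, '[y, k i] <= 0) -> '[y, v] <= 0) -> cone_hull k v.
Proof.
elim: m k v => [|m IH] k v kv.
  exists (fun=> 0) => //; rewrite big_ord0.
  have /eqP : `|v| ^+ 2 = 0.
    by apply/le_anti; rewrite sqr_ge0 andbT hdot_normE kv// => -[].
  by rewrite sqrf_eq0 normr_eq0 => /eqP.
pose k' (i : 'I_m) := k (lift ord0 i).
case: (pselect (forall y, (forall i, '[y, k' i] <= 0) -> '[y, v] <= 0)).
  move=> /IH[r r0 <-].
  exists (fun i => if unlift ord0 i is Some j then r j else 0) => [i|] /=.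
    by case: unliftP.
  rewrite big_ord_recl unlift_none scale0r add0r.
  by apply: eq_bigr => i _; rewrite liftK.
move=> /existsNP[y0 /not_implyP[y0k /negP]]; rewrite -ltNge => y0v.
have y0k0 : 0 < '[y0, k ord0].
  rewrite ltNge; apply/negP => y0k0; move: y0v; rewrite ltNge kv// => i.
  by case: (unliftP ord0 i) => [j ->|->//]; exact: y0k.
set d := '[y0, k ord0] in y0k0.
pose elim_k0 w := w - ('[y0, w] / d) *: k ord0.
have elimE y w : '[y, elim_k0 w] = '[y - ('[y, k ord0] / d) *: y0, w].
  by rewrite hdotBr hdotBl hdotZr hdotZl mulrAC [in RHS]mulrAC
    ['[y0, w] * _]mulrC.
have [y yk|r r0 rv] := IH (elim_k0 \o k') (elim_k0 v).
  rewrite elimE; apply: kv => i; case: (unliftP ord0 i) => [j ->|->].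
    by rewrite -elimE; exact: yk.
  by rewrite hdotBl hdotZl -/d divfK ?subrr ?gt_eqF.
pose r_k0 := '[y0, v] / d - \sum_(i < m) r i * ('[y0, k' i] / d).
exists (fun i => if unlift ord0 i is Some j then r j else r_k0) => [i|] /=.
  case: unliftP => [j _|_]; first exact: r0.
  rewrite subr_ge0 (@le_trans _ _ 0)//; last by rewrite divr_ge0// ltW.
  apply: sumr_le0 => j _; rewrite mulr_ge0_le0//.
  by rewrite mulr_le0_ge0// invr_ge0 ltW.
have -> : v = elim_k0 v + ('[y0, v] / d) *: k ord0 by rewrite subrK.
rewrite -rv big_ord_recl unlift_none scalerBl scaler_suml addrC addrCA [RHS]addrC.
congr (_ + _); rewrite -sumrB; apply: eq_bigr => i _.
by rewrite liftK /= /elim_k0 scalerBr scalerA.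
Qed.

End cones.

Theorem theorem3p12 (R : realType) (H : hilbertType R) (m : nat)
    (k : 'I_m -> H) :
  let C := cone_hull k in
  (forall (x : H) (rho : 'I_m -> R),
      (forall i, 0 <= rho i) ->
      (forall i, '[x, k i] - \sum_(j < m) rho j * '[k j, k i] <= 0) ->
      (forall i,
        rho i * ('[x, k i] - \sum_(j < m) rho j * '[k j, k i]) = 0) ->
      metric_proj (dual_cone C) x = x - \sum_(i < m) rho i *: k i /\
      metric_proj C x = \sum_(i < m) rho i *: k i) /\
  (forall x x0 : H, dual_cone C x0 ->
      (x0 = metric_proj (dual_cone C) x <->
       exists rho : 'I_m -> R,
         (forall i, '[x0, k i] = 0 -> 0 <= rho i) /\
         x0 = x - \sum_(i < m | '[x0, k i] == 0) rho i *: k i)).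
Proof.
move=> C; split=> [x rho rho0 le0 slack|x x0 Cx0].
  set c := \sum_(i < m) rho i *: k i.
  have xcE i : '[x - c, k i] = '[x, k i] - \sum_(j < m) rho j * '[k j, k i].
    rewrite hdotBl (hdotC c) hdot_sumr; congr (_ - _).
    by apply: eq_bigr => j _; rewrite hdotZr hdotC.
  have [] := @orthogonal_decomposition_proj _ _ C (x - c) c.
  - exact: convex_cone_hull.
  - by rewrite /C dual_cone_hullE => i; rewrite xcE.
  - by exists rho.
  - by rewrite hdot_sumr big1// => i _; rewrite hdotZr xcE.
  - by rewrite subrK.
split=> [x0E|[rho [rho0 x0E]]].
  have /best_approx_dual_cone : best_approx (dual_cone C) x x0.
    rewrite x0E; apply: metric_projP.
    - by exists 0; exact: dual_cone0.
    - exact: closed_dual_cone.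
    - exact: convex_dual_cone.
  move=> [orth obt].
  have [|rho rho0 rhoE] := @farkas _ _ m k (x - x0).
    by move=> y yk; rewrite hdotC obt// /C dual_cone_hullE.
  exists rho; split=> [i _|]; first exact: rho0.
  have term_ge0 i : true -> 0 <= - (rho i * '[x0, k i]).
    move=> _; rewrite oppr_ge0 mulr_ge0_le0//.
    by move: Cx0; rewrite /C dual_cone_hullE; apply.
  have sum0 : \sum_(i < m) - (rho i * '[x0, k i]) = 0.
    move: orth; rewrite hdotC -rhoE hdot_sumr => orth.
    apply/eqP; rewrite sumrN oppr_eq0; apply/eqP; rewrite -[RHS]orth.
    by apply: eq_bigr => i _; rewrite hdotZr.
  have slack i : '[x0, k i] != 0 -> rho i = 0.
    move=> /negbTE k0; have /eqP := psumr_eq0P term_ge0 sum0 (i := i) isT.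
    by rewrite oppr_eq0 mulf_eq0 k0 orbF => /eqP.
  have -> : \sum_(i < m | '[x0, k i] == 0) rho i *: k i = x - x0.
    rewrite -rhoE [RHS](bigID (fun i => '[x0, k i] == 0))/=.
    by rewrite [X in _ + X]big1 ?addr0// => i /slack ->; rewrite scale0r.
  by rewrite opprB addrCA subrr addr0.
set c := \sum_(i < m | _) _ in x0E.
have Cc : C c.
  exists (fun i => if '[x0, k i] == 0 then rho i else 0) => [i|] /=.
    by case: eqP => [/rho0//|_]; exact: lexx.
  rewrite /c [RHS]big_mkcond; apply: eq_bigr => i _.
  by case: eqP => // _; rewrite scale0r.
have x0c : '[x0, c] = 0.
  by rewrite hdot_sumr big1// => i /eqP k0; rewrite hdotZr k0 mulr0.
have [+ _] := orthogonal_decomposition_proj (@convex_cone_hull _ _ _ k) Cx0 Cc x0c.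
by rewrite [in X in metric_proj _ X]x0E subrK.
Qed.
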